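(* Let $Y$ be a mean zero random vector in $\mathbb{R}^p$. The stochastic process $\mathbb{S}(u)=\langle u,Y\rangle$ defined on $\mathbb{R}^p$ is even if and only if $Y\overset{d}{=}-Y$. Hence, if $Y$ is symmetric (i.e. $Y\overset{d}{=}-Y$), if the deterministic function $u\mapsto\mathbb{D}(u)+\mathbb{X}(u)$ is even, and if $W=\arg\min_{u\in\mathbb{R}^p}\,\mathbb{D}(u)+\langle u,Y\rangle+\mathbb{X}(u)$ exists and is unique almost surely, then $W\overset{d}{=}-W$.
   Context: A stochastic process $u\mapsto\mathbb{S}(u)$ on $\mathbb{R}^p$ is called even if $u\mapsto\mathbb{S}(u)$ and $u\mapsto\mathbb{S}(-u)$ share the same law, i.e. for all $k\ge1$ and $u_1,\dots,u_k\in\mathbb{R}^p$, $(\mathbb{S}(u_1),\ldots,\mathbb{S}(u_k))\overset{d}{=}(\mathbb{S}(-u_1),\ldots,\mathbb{S}(-u_k))$; a deterministic function $f$ is even if $f(-u)=f(u)$ for all $u$. Here $\mathbb{D}(\cdot)$ is a deterministic non-negative function with a global minimum at zero, $\mathbb{D}(0)=0$, and $\mathbb{X}(\cdot)$ is the indicator function of some cone $\Theta^\star\subseteq\mathbb{R}^p$ in the sense of optimization: $\mathbb{X}=0$ on $\Theta^\star$ and $\mathbb{X}=+\infty$ off $\Theta^\star$.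
   Formalization: The formal theorem additionally assumes that the function D + X is Borel measurable; without such a regularity assumption the claim about W can fail, even when W is a measurable random vector. *)

(* Defs.v *)
From HB Require Import structures.
From mathcomp Require Import all_boot all_order all_algebra.
From mathcomp Require Import all_classical all_reals all_analysis.
From mathcomp Require Import measurable_realfun.

Set Implicit Arguments.
Unset Strict Implicit.
Unset Printing Implicit Defensive.

Import Order.TTheory GRing.Theory Num.Theory.
Import numFieldNormedType.Exports.

Local Open Scope classical_set_scope.
Local Open Scope ring_scope.

(* Borel sigma-algebra of the usual topology of R^n. *)
Fact borel_rV_display : measure_display.
Proof. exact: default_measure_display. Qed.

Section borel_rV.
Variables (R : realType) (n : nat).

HB.instance Definition _ := @isMeasurable.Build borel_rV_display 'rV[R]_n
  <<s (@open 'rV[R]_n) >> (@sigma_algebra0 _ setT (@open 'rV[R]_n))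
  (@sigma_algebraC _ (@open 'rV[R]_n))
  (@sigma_algebra_bigcup _ setT (@open 'rV[R]_n)).

Lemma open_measurable_rV (A : set 'rV[R]_n) : open A -> measurable A.
Proof. by move=> oA; apply: sub_sigma_algebra. Qed.

Definition inner (u v : 'rV[R]_n) : R := \sum_(i < n) u 0 i * v 0 i.

Lemma measurable_coord (i : 'I_n) :
  measurable_fun [set: 'rV[R]_n] (fun v : 'rV[R]_n => v 0 i).
Proof.
apply: (measurability _ (@RGenOpens.measurableE R)) => _ [_ [a [b ->] <-]].
rewrite setTI; apply: open_measurable_rV.
by move: (@coord_continuous R 1 n 0 i) => /continuousP; apply; exact: interval_open.
Qed.

Lemma measurable_inner (u : 'rV[R]_n) :
  measurable_fun [set: 'rV[R]_n] (inner u).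
Proof.
apply: measurable_sum => i; apply: measurable_funM => //.
exact: measurable_coord.
Qed.

End borel_rV.

Section laws.
Context {R : realType} {d : measure_display} {T : measurableType d}.
Variable P : probability T R.

Definition eq_law {d' : measure_display} {T' : measurableType d'}
    (X X' : T -> T') : Prop :=
  forall B : set T', measurable B -> pushforward P X B = pushforward P X' B.

Definition mean_zero {n : nat} (Y : {RV P >-> 'rV[R]_n}) : Prop :=
  forall i : 'I_n, (fun w => Y w ord0 i) \in Lfun P 1%E /\
    ('E_P[fun w => Y w ord0 i] = 0)%E.

Definition symmetric_law {n : nat} (X : {RV P >-> 'rV[R]_n}) : Prop :=
  eq_law X (fun w => - X w).

Definition even_process {n : nat} (S : 'rV[R]_n -> {RV P >-> R}) : Prop :=
  forall (k : nat) (u : 'I_k -> 'rV[R]_n), (1 <= k)%N ->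
    eq_law (fun w => \row_(j < k) S (u j) w)
           (fun w => \row_(j < k) S (- u j) w).

Section linear_process.
Variables (n : nat) (Y : {RV P >-> 'rV[R]_n}).

Definition linear_process_fun (u : 'rV[R]_n) : T -> R := inner u \o Y.

Lemma measurable_linear_process (u : 'rV[R]_n) :
  measurable_fun [set: T] (linear_process_fun u).
Proof.
by apply: measurableT_comp; [exact: measurable_inner | exact: measurable_funPT].
Qed.

HB.instance Definition _ (u : 'rV[R]_n) :=
  isMeasurableFun.Build _ _ _ _ (linear_process_fun u)
    (measurable_linear_process u).

Definition linear_process (u : 'rV[R]_n) : {RV P >-> R} :=
  linear_process_fun u.

End linear_process.

End laws.

Section optimization.
Context {R : realType} {n : nat}.

(* No condition is imposed at the origin, so that this covers both the cones
   that are required to contain 0 and those that are not. *)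
Definition is_cone (C : set 'rV[R]_n) : Prop :=
  forall (t : R) (u : 'rV[R]_n), 0 < t -> C u -> C (t *: u).

Definition cvx_indic (C : set 'rV[R]_n) (u : 'rV[R]_n) : \bar R :=
  if u \in C then 0%E else +oo%E.

Definition is_argmin (f : 'rV[R]_n -> \bar R) (u : 'rV[R]_n) : Prop :=
  forall v, (f u <= f v)%E.

Definition is_unique_argmin (f : 'rV[R]_n -> \bar R) (u : 'rV[R]_n) : Prop :=
  is_argmin f u /\ forall v, is_argmin f v -> v = u.

End optimization.

(* Main.v *)
(* Symmetry of Y from evenness of <u, Y> follows by evaluating the process at
   the canonical basis.  For the argmin W, write G for the set of pairs (y, u)
   such that u minimizes D + X + <., y>: it is Borel, because the optimal value
   is an upper semicontinuous function of y, and it is invariant under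
   (y, u) |-> (-y, -u).  By inner regularity of the law of (Y, W), the event
   W in B is approximated by (Y, W) in K, with K compact inside the part of G
   over B.  Then Y lies in the projection L of K; -Y lies in L with the same
   probability, and in that case uniqueness of the argmin puts -W in B. *)
Require Import Defs.
From HB Require Import structures.
From mathcomp Require Import all_boot all_order all_algebra.
From mathcomp Require Import all_classical all_reals all_analysis.
From mathcomp Require Import measurable_realfun.
Import Order.TTheory GRing.Theory Num.Theory.
Import numFieldNormedType.Exports.
Local Open Scope classical_set_scope.
Local Open Scope ring_scope.

(** * Inner regularity along countable unions and intersections *)

Section inner_regularity.
Context {R : realType} {d : measure_display} {T : measurableType d}.
Variables (P : probability T R) (X : topologicalType) (Z : T -> X).

(* Compact sets of [X] need not be measurable (there is no sigma-algebra on
   [X]), hence the measurability conditions on the preimages. *)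
Definition inner_regular (A : set X) : Prop :=
  measurable (Z @^-1` A) /\
  forall e : R, 0 < e -> exists K : set X,
    [/\ compact K, K `<=` A, measurable (Z @^-1` K) &
        (P (Z @^-1` A `\` Z @^-1` K) < e%:E)%E].

Lemma compact_inner_regular (K : set X) :
  compact K -> measurable (Z @^-1` K) -> inner_regular K.
Proof.
move=> cK mK; split=> // e e0; exists K; split=> //.
by rewrite setDv measure0 lte_fin.
Qed.

Lemma inner_regular_approx (A : (set X)^nat) (e : R) :
  (forall n, inner_regular (A n)) -> 0 < e ->
  exists K : (set X)^nat,
    [/\ forall n, compact (K n), forall n, K n `<=` A n,
        forall n, measurable (Z @^-1` K n) &
        (P (\bigcup_n (Z @^-1` A n `\` Z @^-1` K n)) < e%:E)%E].
Proof.
move=> regA e0.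
(* These bounds sum to [e / 2]: summation only preserves a weak inequality, and the spare half makes
   it strict. *)
have /choice[K KP] n := (regA n).2 (e / 2 / (2 ^ n.+1)%:R)
  ltac:(by rewrite !divr_gt0 ?ltr0n ?expn_gt0).
have mA n := (regA n).1.
exists K; split; try by move=> n; have [] := KP n.
have mD n : measurable (Z @^-1` A n `\` Z @^-1` K n).
  by apply: measurableD => //; have [] := KP n.
apply: (@le_lt_trans _ _ (e / 2)%:E); last first.
  by rewrite lte_fin ltr_pdivrMr// ltr_pMr// ltr1n.
apply: (@le_trans _ _ (\sum_(n <oo) P (Z @^-1` A n `\` Z @^-1` K n))%E).
  by apply: measure_sigma_subadditive => //; exact: bigcup_measurable.
apply: le_trans (epsilon_trick0 xpredT _); last by rewrite divr_ge0// ltW.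
by apply: lee_nneseries => // n _; apply: ltW; have [] := KP n.
Qed.

(** Finite unions [L N] of the approximating compact sets are compact, and what they miss decreases
    to a set of probability below [e]; continuity from above then provides [N]. *)
Lemma inner_regular_bigcup (A : (set X)^nat) :
  (forall n, inner_regular (A n)) -> inner_regular (\bigcup_n A n).
Proof.
move=> regA; have mA n := (regA n).1.
split; first by rewrite preimage_bigcup; exact: bigcup_measurable.
move=> e /(inner_regular_approx _ _ regA)[K [cK KA mK PK]].
pose L N := \big[setU/set0]_(i < N) K i.
pose F N := Z @^-1` (\bigcup_n A n) `\` Z @^-1` L N.
have mL N : measurable (Z @^-1` L N).
  rewrite /L; elim/big_ind : _ => //; first by rewrite preimage_set0.
  by move=> ? ? ? ?; rewrite preimage_setU; exact: measurableU.
have mF N : measurable (F N).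
  apply: measurableD; last exact: mL.
  by rewrite preimage_bigcup; exact: bigcup_measurable.
have capF : \bigcap_N F N `<=` \bigcup_n (Z @^-1` A n `\` Z @^-1` K n).
  move=> w Fw; have [[n _ Anw] _] := Fw 0%N I.
  (* [L N] stops before index [N], so [K n] first enters at [n.+1]. *)
  exists n => //; split=> // Kw; have [_] := Fw n.+1 I; apply.
  by rewrite /L /= big_ord_recr; right.
have mcapF : measurable (\bigcap_N F N) by exact: bigcap_measurableType.
have ltF : (P (\bigcap_N F N) < e%:E)%E.
  apply: le_lt_trans PK; apply: le_measure; rewrite ?inE//.
  by apply: bigcup_measurable => n _; exact: measurableD.
have niF : nonincreasing_seq F.
  move=> m n mn; apply/subsetPset => w [Aw nLw]; split=> //.
  by apply: contra_not nLw; exact: (@subset_bigsetU _ K _ _ mn).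
have F0 : (P (F 0%N) < +oo)%E by rewrite ltey_eq fin_num_measure.
have := nonincreasing_cvg_mu F0 mF mcapF niF.
move=> /(_ _ (open_ereal_lt' ltF))[N _ /(_ N (leqnn N))/= PF].
exists (L N); split=> //; first exact: bigsetU_compact.
rewrite /L; elim/big_ind : _ => //; first by move=> ? ? ? ?; rewrite subUset.
by move=> i _; apply: subset_trans (bigcup_sup I); exact: KA.
Qed.

Hypothesis hX : hausdorff_space X.

(** In a Hausdorff space the compact sets [K n] are closed, so their intersection is a closed subset
    of [K 0]. *)
Lemma inner_regular_bigcap (A : (set X)^nat) :
  (forall n, inner_regular (A n)) -> inner_regular (\bigcap_n A n).
Proof.
move=> regA; have mA n := (regA n).1.
split; first by rewrite preimage_bigcap; exact: bigcap_measurableType.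
move=> e /(inner_regular_approx _ _ regA)[K [cK KA mK PK]].
have mcapK : measurable (Z @^-1` (\bigcap_n K n)).
  by rewrite preimage_bigcap; exact: bigcap_measurableType.
exists (\bigcap_n K n); split=> //.
- apply: (subclosed_compact _ (cK 0%N)); last exact: bigcap_inf.
  by apply: closed_bigI => n _; exact: compact_closed.
- by apply: subset_bigcap => n _; exact: KA.
apply: le_lt_trans PK; apply: le_measure; rewrite ?inE.
- apply: measurableD => //.
  by rewrite preimage_bigcap; exact: bigcap_measurableType.
- by apply: bigcup_measurable => n _; exact: measurableD.
move=> w [Aw /existsNP[n /not_implyP[_ nKw]]].
by exists n => //; split=> //; exact: Aw.
Qed.

(** Regularity of the complement is built into the class, which makes it stable under complements; a
    countable union then uses unions for the sets and intersections for their complements. *)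
Lemma sigma_algebra_inner_regular : inner_regular setT ->
  sigma_algebra setT [set A | inner_regular A /\ inner_regular (~` A)].
Proof.
move=> regT; split.
- split; last by rewrite setC0.
  by apply: compact_inner_regular; [exact: compact0|rewrite preimage_set0].
- by move=> A [rA rCA]; rewrite setTD; split=> //=; rewrite setCK.
- move=> A rA; split; first by apply: inner_regular_bigcup => n; have [] := rA n.
  by rewrite setC_bigcup; apply: inner_regular_bigcap => n; have [] := rA n.
Qed.

End inner_regularity.

(** * Sigma-compactness of closed and open sets *)

Section borel_rV.
Context {R : realType} {n : nat}.
Implicit Types A B C U : set 'rV[R]_n.

Lemma compact_measurable_rV C : compact C -> measurable C.
Proof.
move=> cC; rewrite -[C]setCK; apply: measurableC; apply: open_measurable_rV.
by apply: closed_openC; apply: compact_closed cC; exact: norm_hausdorff.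
Qed.

Definition sigma_compact A :=
  exists2 K : (set 'rV[R]_n)^nat, (forall k, compact (K k)) & A = \bigcup_k K k.

Lemma bigcup_le_norm : \bigcup_k [set v : 'rV[R]_n | `|v| <= k%:R] = setT.
Proof.
rewrite -subTset => v _; exists (Num.truncn `|v|).+1 => //=.
by apply: ltW; exact: truncnS_gt.
Qed.

Lemma closed_le_norm (r : R) : closed [set v : 'rV[R]_n | `|v| <= r].
Proof.
rewrite (_ : mkset _ = Num.norm @^-1` [set x | x <= r])//.
by apply: closed_comp; [move=> ? _; exact: norm_continuous|exact: closed_le].
Qed.

Lemma compact_closed_le_norm C (r : R) :
  closed C -> compact (C `&` [set v : 'rV[R]_n | `|v| <= r]).
Proof.
move=> clC; apply: bounded_closed_compact.
  exists r; split; first exact: num_real.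
  by move=> x rx v [_ /= /le_trans]; apply; exact: ltW.
by apply: closedI => //; exact: closed_le_norm.
Qed.

Lemma closed_sigma_compact C : closed C -> sigma_compact C.
Proof.
move=> clC; exists (fun k => C `&` [set v | `|v| <= k%:R]) => [k|].
  exact: compact_closed_le_norm.
by rewrite -setI_bigcupr bigcup_le_norm setIT.
Qed.

Lemma open_sigma_compact U : open U -> sigma_compact U.
Proof.
move=> oU.
(* [F k] is closed: its complement is the union of the balls of this radius centred outside [U]. *)
pose F k := [set v : 'rV[R]_n | ball v k.+1%:R^-1 `<=` U].
exists (fun k => F k `&` [set v | `|v| <= k%:R]) => [k|].
  apply: compact_closed_le_norm.
  have -> : F k = ~` \bigcup_(y in ~` U) ball y k.+1%:R^-1.
    apply/seteqP; split=> v /=.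
      by move=> Fv [y nUy] /ball_sym/Fv.
    move=> nv y vy; apply: contrapT => nUy; apply: nv.
    by exists y => //; exact: ball_sym.
  apply: open_closedC; apply: bigcup_open => y _.
  exact: ball_open.
apply/seteqP; split=> [v Uv|v [k _ [+ _]]]; last first.
  by apply; exact: ballxx.
have /nbhs_ballP[e /= e0 eU] := open_nbhs_nbhs (conj oU Uv).
have [i _ vi] : (\bigcup_k [set v : 'rV[R]_n | `|v| <= k%:R]) v.
  by rewrite bigcup_le_norm.
(* This [m] serves both the norm bound [i] and the radius, since [m.+1] exceeds [e^-1]. *)
pose m := maxn i (Num.truncn e^-1).
exists m => //; split; last first.
  by apply: (le_trans vi); rewrite ler_nat leq_maxl.
move=> y vy; apply: eU; apply: le_ball vy.
rewrite invf_ple ?posrE ?ltr0n//; apply/ltW/(lt_le_trans (truncnS_gt _)).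
by rewrite ler_nat ltnS leq_maxr.
Qed.

End borel_rV.

(** * Inner regularity of the joint law of [Y] and [W] *)

Section joint_inner_regularity.
Context {R : realType} {d : measure_display} {T : measurableType d} {n : nat}.
Variables (P : probability T R) (Y W : {RV P >-> 'rV[R]_n}).
Let Z w := (Y w, W w).

Lemma measurable_RV_preimage (X : {RV P >-> 'rV[R]_n}) (B : set 'rV[R]_n) :
  measurable B -> measurable (X @^-1` B).
Proof. by move=> mB; exact: measurable_funPTI. Qed.

Lemma inner_regular_setX (A B : set 'rV[R]_n) :
  sigma_compact A -> sigma_compact B -> inner_regular P _ Z (A `*` B).
Proof.
move=> [K cK ->] [L cL ->].
have -> : (\bigcup_k K k) `*` (\bigcup_k L k) =
    \bigcup_k \bigcup_l (K k `*` L l).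
  apply/seteqP; split=> [[x y] [[k _ Kx] [l _ Ly]]|[x y] [k _ [l _ [Kx Ly]]]].
    by exists k => //; exists l.
  by split; [exists k|exists l].
apply: inner_regular_bigcup => k; apply: inner_regular_bigcup => l.
apply: compact_inner_regular; first exact: compact_setX.
rewrite (_ : _ @^-1` _ = Y @^-1` K k `&` W @^-1` L l)//.
by apply: measurableI; apply: measurable_RV_preimage;
  exact: compact_measurable_rV.
Qed.

(** A good-sets argument on two levels: the product sigma-algebra is generated by preimages of Borel
    sets under the projections, and these Borel sets by open sets, which are sigma-compact along
    with their complements. *)
Lemma measurable_inner_regular (A : set ('rV[R]_n * 'rV[R]_n)) :
  measurable A -> inner_regular P _ Z A.
Proof.
have sT : sigma_compact [set: 'rV[R]_n] by exact: closed_sigma_compact closedT.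
have rT : inner_regular P _ Z setT by rewrite -setXTT; exact: inner_regular_setX.
have hX : hausdorff_space ('rV[R]_n * 'rV[R]_n)%type by exact: norm_hausdorff.
pose S := [set A | inner_regular P _ Z A /\ inner_regular P _ Z (~` A)].
have sigmaS : sigma_algebra setT S by exact: sigma_algebra_inner_regular.
have preS (f : _ -> 'rV[R]_n) (B : set 'rV[R]_n) : measurable B ->
    (forall U, sigma_compact U -> inner_regular P _ Z (f @^-1` U)) ->
    S (f @^-1` B).
  move=> mB rf; rewrite -[f @^-1` B]setTI.
  suff : measurable `<=` image_set_system setT f S by exact.
  apply: smallest_sub; first exact: sigma_algebra_image.
  move=> U oU; rewrite /image_set_system/= setTI; split.
    by apply: rf; exact: open_sigma_compact.
  rewrite preimage_setC; apply: rf.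
  by apply: closed_sigma_compact; exact: open_closedC.
suff H : measurable `<=` S by move=> /H[].
apply: smallest_sub => // _ [|] [B mB <-]; rewrite setTI; apply: preS => // U sU.
- by rewrite -setXT; exact: inner_regular_setX.
- by rewrite -setTX; exact: inner_regular_setX.
Qed.

End joint_inner_regularity.

(** * Continuity and the inner product *)

Section continuity_rV.
Context {R : realType} {n : nat}.

Lemma continuous_rV (X : topologicalType) (f : X -> 'rV[R]_n) :
  (forall j, continuous (fun x => f x 0 j)) -> continuous f.
Proof.
move=> cf x; apply/cvg_ballP => e e0.
have H : \forall y \near x, forall j, ball (f x 0 j) e (f y 0 j).
  by apply: filter_forall => j; move/cvg_ballP: (cf j x); exact.
by apply: filterS H => y fxy; split=> // i j; rewrite ord1.
Qed.

Lemma inner_continuous (u : 'rV[R]_n) : continuous (inner u).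
Proof.
apply: (continuous_big (@add_continuous R^o) (F := fun i (v : 'rV[R]_n) => u 0 i * v 0 i)).
move=> i _ v.
by apply: continuousM; [exact: cst_continuous|exact: coord_continuous].
Qed.

Lemma innerN (u v : 'rV[R]_n) : inner (- u) v = - inner u v.
Proof. by rewrite /inner -sumrN; apply: eq_bigr => i _; rewrite mxE mulNr. Qed.

Lemma innerrN (u v : 'rV[R]_n) : inner u (- v) = - inner u v.
Proof. by rewrite /inner -sumrN; apply: eq_bigr => i _; rewrite mxE mulrN. Qed.

Lemma inner_delta (j : 'I_n) (v : 'rV[R]_n) : inner (delta_mx 0 j) v = v 0 j.
Proof.
rewrite /inner (bigD1 j)//= mxE !eqxx mul1r big1 ?addr0// => i ij.
by rewrite mxE (negbTE ij) andbF mul0r.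
Qed.

End continuity_rV.

Lemma continuous_measurable_rV (R : realType) (m n : nat)
    (f : 'rV[R]_m -> 'rV[R]_n) : continuous f -> measurable_fun setT f.
Proof.
move=> /continuousP cf; apply: (measurability (@open 'rV[R]_n)) => //.
by move=> _ [U oU <-]; rewrite setTI; apply: open_measurable_rV; exact: cf.
Qed.

Lemma measurable_preimageN_rV (R : realType) (n : nat) (B : set 'rV[R]_n) :
  measurable B -> measurable (-%R @^-1` B).
Proof.
move=> mB; rewrite -[X in measurable X]setTI.
by apply: (@continuous_measurable_rV _ n n -%R) => //; exact: opp_continuous.
Qed.

(** * Linear perturbations of a function and their minimizers *)

Section perturbed_argmin.
Context {R : realType} {n : nat}.
Variable g : 'rV[R]_n -> \bar R.

(** Here [g] stands for the whole deterministic part [D + X]. *)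
Definition perturb (y u : 'rV[R]_n) : \bar R := (g u + (inner u y)%:E)%E.

Definition perturb_inf (y : 'rV[R]_n) : \bar R := ereal_inf (range (perturb y)).

(** Replaces a condition over uncountably many [v] by an equality of two functions of [(y, u)],
    whose measurability can be checked. *)
Lemma is_argmin_perturb_inf (y u : 'rV[R]_n) :
  is_argmin (perturb y) u <-> perturb y u = perturb_inf y.
Proof.
split=> [amin|uE v]; last by rewrite uE; apply: ereal_inf_lbound; exists v.
apply/eqP; rewrite eq_le; apply/andP; split.
  by apply/ereal_infP => _ [v _ <-]; exact: amin.
by apply: ereal_inf_lbound; exists u.
Qed.

(* An infimum of affine functions of [y] is upper semicontinuous, whatever [g]. *)
Lemma measurable_perturb_inf : measurable_fun setT perturb_inf.
Proof.
apply: (measurability _ (ErealGenInftyO.measurableE R)) => _ [_ [r ->] <-].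
rewrite setTI; apply: open_measurable_rV.
rewrite (_ : _ @^-1` _ = \bigcup_u [set y | (perturb y u < r%:E)%E]).
  (* For finite [g u] this is a strict affine inequality in [y]; the values [+oo] and [-oo] give the
     empty set and the whole space. *)
  apply: bigcup_open => u _; rewrite /perturb; case: (g u) => [s| |] /=.
  - rewrite (_ : mkset _ = inner u @^-1` [set x | x < r - s]).
      by apply: open_comp; [move=> ? _; exact: inner_continuous|exact: open_lt].
    by apply/seteqP; split=> y /=; rewrite -EFinD lte_fin ltrBrDl.
  - by rewrite (_ : mkset _ = set0)//; apply/seteqP; split=> y.
  - rewrite (_ : mkset _ = setT); first exact: openT.
    by apply/seteqP; split=> y //= _; rewrite ltNyr.
apply/seteqP; split=> y /=; rewrite in_itv/=.
  by move=> /ereal_inf_lt[_ [u _ <-] ur]; exists u.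
by move=> [u _]; apply: le_lt_trans; apply: ereal_inf_lbound; exists u.
Qed.

Lemma measurable_argmin_graph : measurable_fun setT g ->
  measurable [set yu : 'rV[R]_n * 'rV[R]_n | is_argmin (perturb yu.1) yu.2].
Proof.
move=> mg; rewrite (_ : mkset _ =
    setT `&` [set yu | perturb yu.1 yu.2 = perturb_inf yu.1]).
  apply: measurable_eqe => //.
    apply: emeasurable_funD; first exact: measurableT_comp mg measurable_snd.
    apply/measurable_EFinP; apply: measurable_sum => i; apply: measurable_funM.
      exact: measurableT_comp (measurable_coord i) measurable_snd.
    exact: measurableT_comp (measurable_coord i) measurable_fst.
  exact: measurableT_comp measurable_perturb_inf measurable_fst.
by rewrite setTI; apply/seteqP; split=> -[y u] /is_argmin_perturb_inf.
Qed.

Hypothesis g_even : forall u, g (- u) = g u.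

(** Reflecting the competitor [v] turns the objective at [- y] into the one at [y], as [g] is even
    and the two signs in the inner product cancel. *)
Lemma is_argmin_perturbN (y u : 'rV[R]_n) :
  is_argmin (perturb (- y)) u -> is_argmin (perturb y) (- u).
Proof.
move=> amin v; have := amin (- v).
by rewrite /perturb !g_even !innerN !innerrN !opprK.
Qed.

End perturbed_argmin.

(** * Symmetry of the argmin *)

Section argmin_law.
Context {R : realType} {d : measure_display} {T : measurableType d} {n : nat}.
Variables (P : probability T R) (Y W : {RV P >-> 'rV[R]_n}).
Variable g : 'rV[R]_n -> \bar R.
Hypotheses (mg : measurable_fun setT g) (g_even : forall u, g (- u) = g u).
Hypothesis argminW : {ae P, forall w, is_unique_argmin (perturb g (Y w)) (W w)}.
Hypothesis symY : symmetric_law Y.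

Lemma measurable_oppRV (X : {RV P >-> 'rV[R]_n}) (B : set 'rV[R]_n) :
  measurable B -> measurable ((fun w => - X w) @^-1` B).
Proof.
move=> mB; rewrite -[X in measurable X]/(X @^-1` (-%R @^-1` B)).
by apply: measurable_RV_preimage; exact: measurable_preimageN_rV.
Qed.

(* The set of [y] having a minimizer in [B] is only analytic, so it is replaced
   by the projection of a compact subset of the graph of the argmin
   correspondence; uniqueness of the argmin is used at the reflected point. *)
Lemma argmin_law_le (B : set 'rV[R]_n) : measurable B ->
  (P (W @^-1` B) <= P ((fun w => (- W w)%R) @^-1` B))%E.
Proof.
move=> mB; case: argminW => N [mN PN0 subN].
have NP w : ~ N w -> is_unique_argmin (perturb g (Y w)) (W w).
  by move=> nNw; apply: contrapT => /subN.
have PUN A : measurable A -> (P (A `|` N) <= P A)%E.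
  move=> mA; apply: (le_trans (measureU2 P mA mN)).
  by rewrite [X in (_ + X)%E]PN0 adde0.
pose G := [set yu : 'rV[R]_n * 'rV[R]_n | is_argmin (perturb g yu.1) yu.2].
pose Z w := (Y w, W w).
have [mZ regG] : inner_regular P _ Z (G `&` (setT `*` B)).
  apply: measurable_inner_regular; apply: measurableI.
    exact: measurable_argmin_graph.
  exact: measurableX.
apply/lee_addgt0Pr => e /regG[K [cK KG mK PK]].
pose L := fst @` K.
have mL : measurable L.
  apply: compact_measurable_rV; apply: continuous_compact => //.
  by apply: continuous_subspaceT => x; exact: cvg_fst.
have mNW := measurable_oppRV W _ mB.
have mNY := measurable_oppRV Y _ mL.
(* The event [W] in [B] is covered by three pieces: [Z] in [K], the graph over [B] missed by [K]
   (mass below [e]), and the null set [N]. *)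
apply: (@le_trans _ _ (P (Z @^-1` K `|`
    ((Z @^-1` (G `&` (setT `*` B)) `\` Z @^-1` K) `|` N)))).
  apply: le_measure; rewrite ?inE.
  - exact: measurable_RV_preimage.
  - by apply: measurableU => //; apply: measurableU => //; exact: measurableD.
  move=> w Bw; have [Nw|nNw] := pselect (N w); first by right; right.
  have [Kw|nKw] := pselect (K (Z w)); first by left.
  by right; left; split=> //; split=> //; exact: (NP _ nNw).1.
apply: (le_trans (measureU2 _ _ _)) => //.
  by apply: measurableU => //; exact: measurableD.
apply: leeD; last first.
  by apply: le_trans (PUN _ (measurableD mZ mK)) _; exact: ltW.
apply: (@le_trans _ _ (P (Y @^-1` L))).
  apply: le_measure; rewrite ?inE//; first exact: measurable_RV_preimage.
  by move=> w Kw; exists (Z w).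
have -> : P (Y @^-1` L) = P ((fun w => - Y w) @^-1` L) by exact: symY.
apply: le_trans (PUN _ mNW).
apply: le_measure; rewrite ?inE//; first exact: measurableU.
(* Here [y] is [- Y w] and [u] in [B] minimizes at [y], so [- u] minimizes at [Y w] and, off [N],
   equals [W w]. *)
move=> w [[y u] /KG[/= Gyu [_ /= Bu]] yE].
have [Nw|nNw] := pselect (N w); [by right|left].
have {}Gyu : is_argmin (perturb g (Y w)) (- u).
  by apply: is_argmin_perturbN => //; rewrite -yE.
by rewrite /= -((NP _ nNw).2 _ Gyu) opprK.
Qed.

Lemma argmin_symmetric_law : symmetric_law W.
Proof.
move=> B mB; apply/eqP; rewrite eq_le; apply/andP; split.
  exact: argmin_law_le.
(* The inequality for the reflected set [-B] is the reverse one for [B]. *)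
apply: le_trans (argmin_law_le _ (measurable_preimageN_rV _ _ _ mB)) _.
rewrite (_ : _ @^-1` (_ @^-1` B) = W @^-1` B)//.
by apply/seteqP; split=> w; rewrite /= opprK.
Qed.

End argmin_law.

(** * Evenness of the linear process *)

Lemma even_linear_processP (R : realType) (d : measure_display)
    (T : measurableType d) (P : probability T R) (n : nat)
    (Y : {RV P >-> 'rV[R]_n}) :
  even_process (linear_process Y) <-> symmetric_law Y.
Proof.
split=> [evS|symY].
  (* In dimension zero the basis is empty while evenness requires at least one point; there [Y] and
     [- Y] coincide. *)
  case: n => [|n] in Y evS *.
    move=> B mB; congr (P _).
    by apply/seteqP; split=> w; rewrite /= (thinmx0 (Y w)) oppr0.
  move=> B mB; have := evS n.+1 (fun j => delta_mx 0 j) isT B mB.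
  rewrite /pushforward => YE; rewrite (_ : Y @^-1` B =
      (fun w => \row_j linear_process Y (delta_mx 0 j) w) @^-1` B); last first.
    apply/seteqP; split=> w; rewrite /= (_ : \row_j _ = Y w)//;
      by apply/rowP => j; rewrite mxE /= /linear_process_fun/= inner_delta.
  rewrite YE; congr (P _).
  apply/seteqP; split=> w; rewrite /= (_ : \row_j _ = - Y w)//;
    by apply/rowP => j; rewrite !mxE /= /linear_process_fun/= innerN inner_delta.
move=> k u k1 B mB.
(* The process at the points [u j] is [L] applied to [Y], and at [- u j] it is [L] applied to
   [- Y]. *)
pose L (v : 'rV[R]_n) := \row_(j < k) inner (u j) v.
have mL : measurable_fun setT L.
  apply: continuous_measurable_rV; apply: continuous_rV => j.
  by under eq_fun do rewrite mxE; exact: inner_continuous.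
have mLB : measurable (L @^-1` B) by rewrite -[X in measurable X]setTI; exact: mL.
have := symY _ mLB; rewrite /pushforward => YE.
rewrite (_ : _ @^-1` B = Y @^-1` (L @^-1` B))// YE; congr (P _).
apply/seteqP; split=> w; rewrite /= (_ : L (- Y w) = \row_j linear_process Y (- u j) w)//;
  by apply/rowP => j; rewrite !mxE /= /linear_process_fun/= innerN innerrN.
Qed.

Theorem corollary3p3 (R : realType) (d : measure_display)
    (T : measurableType d) (P : probability T R) (p : nat)
    (Y : {RV P >-> 'rV[R]_p}) (Y_mean0 : mean_zero Y) :
  (even_process (linear_process Y) <-> symmetric_law Y) /\
  (forall (D : 'rV[R]_p -> R) (C : set 'rV[R]_p) (W : {RV P >-> 'rV[R]_p}),
     (forall u, 0 <= D u) -> D 0 = 0 -> is_cone C ->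
     measurable_fun [set: 'rV[R]_p]
       (fun u => (D u)%:E + cvx_indic C u)%E ->
     symmetric_law Y ->
     (forall u, ((D (- u))%:E + cvx_indic C (- u)
                 = (D u)%:E + cvx_indic C u)%E) ->
     {ae P, forall w,
        is_unique_argmin
          (fun u => (D u)%:E + (linear_process Y u w)%:E + cvx_indic C u)%E
          (W w)} ->
     symmetric_law W).
Proof.
split=> [|D C W _ _ _ mg symY g_even argminW]; first exact: even_linear_processP.
apply: (argmin_symmetric_law P Y W _ mg g_even _ symY).
(* The linear term has to be moved past the indicator to reach the form [perturb]. *)
apply: filterS argminW => w; congr (is_unique_argmin _ _).
by apply/funext => u; rewrite /perturb addeAC.
Qed.
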